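(* Let $\mathscr{A}$ be a $C^*$-algebra and let $\mathscr{X}$ be a full Hilbert $\mathscr{A}$-module. Then the following are equivalent: (i) for all $x,y\in\mathscr{X}$, if $x\perp_B y$ then $\|x+y\|\geq\|y\|$; (ii) $\mathscr{A}$ or $\mathcal{K}(\mathscr{X})$ is isomorphic to $\mathbb{C}$.
   Context: A Hilbert $\mathscr{A}$-module is a right $\mathscr{A}$-module with an $\mathscr{A}$-valued inner product, complete in the norm $\|x\|=\sqrt{\|\langle x,x\rangle\|}$. It is full if the two-sided ideal of $\mathscr{A}$ generated by all $\langle x,y\rangle$, $x,y\in\mathscr{X}$, is dense in $\mathscr{A}$. $x\perp_B y$ (Birkhoff--James orthogonality) means $\|x+\lambda y\|\ge\|x\|$ for all $\lambda\in\mathbb{C}$. $\mathcal{K}(\mathscr{X})$ is the $C^*$-algebra (closed linear span) generated by the operators $\theta_{x,y}(z)=x\langle y,z\rangle$, $x,y\in\mathscr{X}$.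
   Formalization: The module X is assumed to be nonzero; for X = 0 (which by fullness forces A = 0) condition (i) holds trivially while neither A nor K(X) is isomorphic to C, so the equivalence as stated fails in that case. *)

(* Defs.v *)
From HB Require Import structures.
From mathcomp Require Import all_boot all_order all_algebra.
From mathcomp Require Import complex.
From mathcomp Require Import reals.
Set Implicit Arguments. Unset Strict Implicit. Unset Printing Implicit Defensive.
Import Order.TTheory GRing.Theory Num.Theory.
Local Open Scope ring_scope.

Section CstarDefs.
Variable R : realType.
Local Notation C := R[i].
Local Notation cabs := (@Normc.normc R).
Local Notation cconj := (@conjc R).

Definition complete_wrt (V : zmodType) (n : V -> R) : Prop :=
  forall u : nat -> V,
    (forall e : R, 0 < e -> exists N : nat, forall p q : nat,
        (N <= p)%N -> (N <= q)%N -> n (u p - u q) < e) ->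
    exists l : V, forall e : R, 0 < e -> exists N : nat, forall p : nat,
        (N <= p)%N -> n (u p - l) < e.

Record is_cstar_algebra (A : lmodType C) (mul : A -> A -> A) (star : A -> A)
    (nA : A -> R) : Prop := {
  cs_norm_ge0 : forall a, 0 <= nA a;
  cs_norm_eq0 : forall a, nA a = 0 -> a = 0;
  cs_norm_triangle : forall a b, nA (a + b) <= nA a + nA b;
  cs_normZ : forall (c : C) a, nA (c *: a) = cabs c * nA a;
  cs_complete : complete_wrt nA;
  cs_mulA : forall a b c, mul a (mul b c) = mul (mul a b) c;
  cs_mulDl : forall a b c, mul (a + b) c = mul a c + mul b c;
  cs_mulDr : forall a b c, mul a (b + c) = mul a b + mul a c;
  cs_mulZl : forall (k : C) a b, mul (k *: a) b = k *: mul a b;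
  cs_mulZr : forall (k : C) a b, mul a (k *: b) = k *: mul a b;
  cs_norm_mul : forall a b, nA (mul a b) <= nA a * nA b;
  cs_starD : forall a b, star (a + b) = star a + star b;
  cs_starZ : forall (k : C) a, star (k *: a) = cconj k *: star a;
  cs_starK : forall a, star (star a) = a;
  cs_starM : forall a b, star (mul a b) = mul (star b) (star a);
  cs_cstar_identity : forall a, nA (mul (star a) a) = nA a ^+ 2
}.

Definition cs_positive (A : lmodType C) (mul : A -> A -> A) (star : A -> A)
    (a : A) : Prop := exists b, a = mul (star b) b.

Definition hm_norm (A X : lmodType C) (nA : A -> R) (ip : X -> X -> A)
    (x : X) : R := Num.sqrt (nA (ip x x)).

Record is_hilbert_module (A : lmodType C) (mul : A -> A -> A) (star : A -> A)
    (nA : A -> R) (X : lmodType C) (act : X -> A -> X) (ip : X -> X -> A)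
    : Prop := {
  hm_actDl : forall x y a, act (x + y) a = act x a + act y a;
  hm_actDr : forall x a b, act x (a + b) = act x a + act x b;
  hm_actM : forall x a b, act x (mul a b) = act (act x a) b;
  hm_actZl : forall (k : C) x a, act (k *: x) a = k *: act x a;
  hm_actZr : forall (k : C) x a, act x (k *: a) = k *: act x a;
  hm_ipDr : forall x y z, ip x (y + z) = ip x y + ip x z;
  hm_ipZr : forall (k : C) x y, ip x (k *: y) = k *: ip x y;
  hm_ip_act : forall x y a, ip x (act y a) = mul (ip x y) a;
  hm_ip_star : forall x y, star (ip x y) = ip y x;
  hm_ip_pos : forall x, cs_positive mul star (ip x x);
  hm_ip_def : forall x, ip x x = 0 -> x = 0;
  hm_complete : complete_wrt (hm_norm nA ip)
}.

Definition is_two_sided_ideal (A : lmodType C) (mul : A -> A -> A)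
    (I : A -> Prop) : Prop :=
  [/\ I 0, (forall a b, I a -> I b -> I (a + b)),
      (forall (k : C) a, I a -> I (k *: a)) &
      (forall a b, I a -> I (mul a b) /\ I (mul b a))].

Definition generated_ideal (A X : lmodType C) (mul : A -> A -> A)
    (ip : X -> X -> A) (a : A) : Prop :=
  forall I : A -> Prop, is_two_sided_ideal mul I ->
    (forall x y, I (ip x y)) -> I a.

Definition full_module (A X : lmodType C) (mul : A -> A -> A) (nA : A -> R)
    (ip : X -> X -> A) : Prop :=
  forall (a : A) (e : R), 0 < e ->
    exists b, generated_ideal mul ip b /\ nA (a - b) < e.

Definition bj_orth (A X : lmodType C) (nA : A -> R) (ip : X -> X -> A)
    (x y : X) : Prop :=
  forall l : C, hm_norm nA ip x <= hm_norm nA ip (x + l *: y).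

Definition theta (A X : lmodType C) (act : X -> A -> X) (ip : X -> X -> A)
    (x y : X) : X -> X := fun z => act x (ip y z).

Definition theta_comb (A X : lmodType C) (act : X -> A -> X)
    (ip : X -> X -> A) (s : seq (C * X * X)) : X -> X :=
  fun z => \sum_(t <- s) t.1.1 *: theta act ip t.1.2 t.2 z.

(* K(X): the closure, in operator norm, of the linear span of the theta's.
   ||T - S|| <= e is expressed as ||(T - S) z|| <= e ||z|| for all z. *)
Definition compact_ops (A X : lmodType C) (nA : A -> R) (act : X -> A -> X)
    (ip : X -> X -> A) (T : X -> X) : Prop :=
  forall e : R, 0 < e -> exists s : seq (C * X * X),
    forall z, hm_norm nA ip (T z - theta_comb act ip s z)
              <= e * hm_norm nA ip z.

Definition cstar_iso_C (A : lmodType C) (mul : A -> A -> A) (star : A -> A)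
    : Prop :=
  exists phi : A -> C,
    [/\ injective phi, (forall c : C, exists a, phi a = c),
        (forall (k : C) a b, phi (k *: a + b) = k * phi a + phi b),
        (forall a b, phi (mul a b) = phi a * phi b) &
        (forall a, phi (star a) = cconj (phi a))].

Definition compact_iso_C (A X : lmodType C) (nA : A -> R)
    (act : X -> A -> X) (ip : X -> X -> A) : Prop :=
  let K := compact_ops nA act ip in
  exists phi : (X -> X) -> C,
    [/\ (forall S T, K S -> K T -> phi S = phi T -> S = T),
        (forall c : C, exists T, K T /\ phi T = c),
        (forall (k : C) S T, K S -> K T ->
            phi (fun z => k *: S z + T z) = k * phi S + phi T),
        (forall S T, K S -> K T -> phi (fun z => S (T z)) = phi S * phi T) &
        (forall T T', K T -> K T' ->
            (forall x y, ip (T x) y = ip x (T' y)) ->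
            phi T' = cconj (phi T))].

End CstarDefs.

(* Main.v *)
(* If |x| = 1 and a = <x, x>, then x is Birkhoff-James orthogonal to x q(a) for
   q = (1 - t^4)^2, because a has norm 1 and so "attains" the value 1, where q
   vanishes. Symmetry makes x q(a) orthogonal to x, but q > 0 off the points
   where it vanishes, so subtracting a small multiple of x decreases the norm
   unless x q(a) = 0. Hence a^3 = a, and after scaling every y satisfies the
   cube identity <y, y>^3 = |<y, y>|^2 <y, y>: inner squares have at most one
   spectral value up to sign.

   Applied to x h, x + w, etc., the cube identity shows that p = a^2 is a
   projection with p A p = C p and a = p or a = - p, and that w p = 0 and
   <x, w> = 0 force w = 0. If z p = z for all z, fullness gives A = C p.
   Otherwise some b = <x, w> is nonzero with b = p b and b p = 0; if y = y p is
   orthogonal to x then y b = 0, whence y = 0, and therefore every z equals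
   +- x <x, z>, so that every compact operator is a scalar.

   Conversely, both conditions make the norm of X come from a scalar form.

   No functional calculus is needed: positivity enters only through the
   inequality |a g(a) p(a)^2| <= |a g(a) (p(a)^2 + q(a)^2)|, which is a direct
   consequence of the C*-identity. *)

Require Import Defs.
From HB Require Import structures.
From mathcomp Require Import all_boot all_order all_algebra.
From mathcomp Require Import complex.
From mathcomp Require Import reals.
From mathcomp Require Import ring lra.
From mathcomp Require Import boolp.
Import Order.TTheory GRing.Theory Num.Theory.
Local Open Scope ring_scope.
Local Open Scope complex_scope.

Set Implicit Arguments.
Unset Strict Implicit.
Unset Printing Implicit Defensive.

(** * Polynomials in a linear operator *)

Section LinearMaps.
Variables (K : comNzRingType) (U V : lmodType K) (f : U -> V).
Hypothesis lin_f : linear f.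

Lemma lin0 : f 0 = 0.
Proof. by have := lin_f (-1) 0 0; rewrite scaler0 addr0 scaleN1r addNr. Qed.

Lemma linZ k u : f (k *: u) = k *: f u.
Proof. by have := lin_f k u 0; rewrite lin0 !addr0. Qed.

Lemma linD u v : f (u + v) = f u + f v.
Proof. by have := lin_f 1 u v; rewrite !scale1r. Qed.

Lemma linN u : f (- u) = - f u.
Proof. by rewrite -scaleN1r linZ scaleN1r. Qed.

Lemma linB u v : f (u - v) = f u - f v.
Proof. by rewrite linD linN. Qed.

Lemma lin_sum (I : Type) (r : seq I) (F : I -> U) :
  f (\sum_(i <- r) F i) = \sum_(i <- r) f (F i).
Proof. exact: (big_morph f linD lin0). Qed.

End LinearMaps.

Section PolynomialsInOperator.
Variables (K : comNzRingType) (V : lmodType K) (L : V -> V).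
Hypothesis lin_L : linear L.

(** This is p(L) v. Evaluating at a vector gives the constant term a meaning in modules and in
    algebras without unit. *)
Definition pev (v : V) (p : {poly K}) : V :=
  \sum_(i < size p) p`_i *: iter i L v.

Lemma pev_wide n v (p : {poly K}) : (size p <= n)%N ->
  pev v p = \sum_(i < n) p`_i *: iter i L v.
Proof.
move=> sp; rewrite /pev (big_ord_widen n (fun i => p`_i *: iter i L v) sp).
rewrite big_mkcond; apply: eq_bigr => i _; case: ltnP => // pi.
by rewrite nth_default // scale0r.
Qed.

Lemma pev_lin v : linear (pev v).
Proof.
move=> k p q; pose n := maxn (size (k *: p + q)) (maxn (size p) (size q)).
rewrite !(@pev_wide n) ?leq_max ?leqnn ?orbT //.
rewrite scaler_sumr -big_split; apply: eq_bigr => i _ /=.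
by rewrite coefD coefZ scalerDl scalerA.
Qed.

Lemma pevC v c : pev v c%:P = c *: v.
Proof.
rewrite (@pev_wide 1) ?size_polyC ?leq_b1 // big_ord_recl big_ord0 addr0.
by rewrite coefC.
Qed.

Lemma pev1 v : pev v 1 = v.
Proof. by rewrite -polyC1 pevC scale1r. Qed.

Lemma pevMX v p : pev v (p * 'X) = L (pev v p).
Proof.
rewrite (@pev_wide (size p).+1); last first.
  by have [->|p0] := eqVneq p 0; rewrite ?mul0r ?size_poly0 // size_mulX.
rewrite big_ord_recl coefMX scale0r add0r (lin_sum lin_L).
by apply: eq_bigr => i _; rewrite (linZ lin_L) coefMX.
Qed.

Lemma pevX v : pev v 'X = L v.
Proof. by rewrite -['X]mul1r pevMX pev1. Qed.

Lemma pev_pev v p q : pev (pev v p) q = pev v (p * q).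
Proof.
elim/poly_ind: q => [|q c IH].
  by rewrite mulr0 !(lin0 (pev_lin _)).
rewrite (linD (pev_lin _)) pevMX IH pevC mulrDr (linD (pev_lin _)).
by rewrite mulrA pevMX [p * _%:P]mulrC mul_polyC (linZ (pev_lin _)).
Qed.

End PolynomialsInOperator.

(** Used with f a left multiplication or [ip y], both of which carry a right action of b to right
    multiplication by b. *)
Lemma pev_map (K : comNzRingType) (V W : lmodType K) (L : V -> V) (M : W -> W)
    (f : V -> W) v p : linear L -> linear M -> linear f ->
  (forall u, f (L u) = M (f u)) -> f (pev L v p) = pev M (f v) p.
Proof.
move=> lL lM lf fL; elim/poly_ind: p => [|p c IH].
  by rewrite (lin0 (pev_lin _ _)) (lin0 (pev_lin _ _)) (lin0 lf).
rewrite !(linD (pev_lin _ _)) (linD lf) !pevMX // fL IH !pevC.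
by rewrite (linZ lf).
Qed.

(** * Polynomials in a self-adjoint element *)

Section CstarAlgebra.
Variable R : realType.
Local Notation C := R[i].
Local Notation cabs := (@Normc.normc R).
Local Notation cconj := (@conjc R).
Local Notation rpoly := (map_poly (real_complex R)).
Local Notation conjp := (map_poly cconj).

Lemma cabs_real (t : R) : cabs t%:C = `|t|.
Proof. by rewrite /= expr0n /= addr0 sqrtr_sqr. Qed.

Lemma cabs_ge0 (z : C) : 0 <= cabs z.
Proof. by case: z => u v; exact: sqrtr_ge0. Qed.

Lemma cabsN (z : C) : cabs (- z) = cabs z.
Proof. by case: z => u v /=; rewrite !sqrrN. Qed.

Variables (A : lmodType C) (mul : A -> A -> A) (star : A -> A) (nA : A -> R).
Hypothesis HA : is_cstar_algebra mul star nA.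
Local Notation "a ** b" := (mul a b) (at level 40, left associativity).

Lemma mulxA a b c : a ** (b ** c) = a ** b ** c.
Proof. exact: (cs_mulA HA). Qed.

Lemma mul_linr a : linear (mul a).
Proof. by move=> k u v; rewrite (cs_mulDr HA) (cs_mulZr HA). Qed.

Lemma mul_linl b : linear (mul^~ b).
Proof. by move=> k u v; rewrite /= (cs_mulDl HA) (cs_mulZl HA). Qed.

Lemma mulx0 a : a ** 0 = 0. Proof. exact: (lin0 (mul_linr a)). Qed.
Lemma mul0x a : 0 ** a = 0. Proof. exact: (lin0 (mul_linl a)). Qed.

Lemma starD a b : star (a + b) = star a + star b.
Proof. exact: (cs_starD HA). Qed.

Lemma starZ k a : star (k *: a) = cconj k *: star a.
Proof. exact: (cs_starZ HA). Qed.

Lemma star0 : star 0 = 0.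
Proof. by have := starZ 0 0; rewrite scale0r conjc0 scale0r. Qed.

Lemma starN a : star (- a) = - star a.
Proof. by rewrite -scaleN1r starZ rmorphN1 scaleN1r. Qed.

Lemma nA_ge0 a : 0 <= nA a. Proof. exact: (cs_norm_ge0 HA). Qed.

Lemma nA0 : nA 0 = 0.
Proof. by have := cs_normZ HA 0 0; rewrite scale0r Normc.normc0 mul0r. Qed.

Lemma nA_eq0 a : nA a <= 0 -> a = 0.
Proof.
by move=> a0; apply: (cs_norm_eq0 HA); apply/eqP; rewrite eq_le a0 nA_ge0.
Qed.

Lemma nA_gt0 a : a <> 0 -> 0 < nA a.
Proof. by move=> a0; rewrite ltNge; apply/negP => /nA_eq0. Qed.

Lemma nAD a b : nA (a + b) <= nA a + nA b.
Proof. exact: (cs_norm_triangle HA). Qed.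

Lemma nAZ k a : nA (k *: a) = cabs k * nA a.
Proof. exact: (cs_normZ HA). Qed.

Lemma nAZr (t : R) a : nA (t%:C *: a) = `|t| * nA a.
Proof. by rewrite nAZ cabs_real. Qed.

Lemma nAN a : nA (- a) = nA a.
Proof.
by rewrite -scaleN1r -(rmorphN1 (real_complex R)) nAZr normrN1 mul1r.
Qed.

Lemma nAB a b : nA (a - b) <= nA a + nA b.
Proof. by rewrite -(nAN b) nAD. Qed.

Lemma nAM a b : nA (a ** b) <= nA a * nA b.
Proof. exact: (cs_norm_mul HA). Qed.

Lemma nA_cstar a : nA (star a ** a) = nA a ^+ 2.
Proof. exact: (cs_cstar_identity HA). Qed.

Lemma star_mul_eq0 a : star a ** a = 0 -> a = 0.
Proof.
move=> a0; apply: nA_eq0; have := nA_cstar a; rewrite a0 nA0 => /esym/eqP.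
by rewrite sqrf_eq0 => /eqP ->.
Qed.

Section SelfAdjointCalculus.
Variable a : A.
Hypothesis sa : star a = a.

(* [e p] is a p(a), which makes sense without a unit. *)
Local Notation e := (pev (mul^~ a) a).

Let e_lin : linear e. Proof. exact: pev_lin. Qed.

Lemma eMX p : e (p * 'X) = e p ** a.
Proof. by rewrite pevMX //; exact: mul_linl. Qed.

(** Each value of [e] carries one factor a besides its polynomial; the product carries two, hence
    the extra ['X]. *)
Lemma eM p q : e p ** e q = e ('X * (p * q)).
Proof.
rewrite (@pev_map _ _ _ (mul^~ a) (mul^~ a) (mul (e p))).
- by rewrite -eMX pev_pev; [congr (pev _ _ _); ring|exact: mul_linl].
- exact: mul_linl.
- exact: mul_linl.
- exact: mul_linr.
- by move=> u; rewrite mulxA.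
Qed.

Lemma eMXl p : e (p * 'X) = a ** e p.
Proof.
transitivity (e 1 ** e p); last by rewrite pev1.
by rewrite eM mul1r mulrC.
Qed.

Lemma e_star p : star (e p) = e (conjp p).
Proof.
elim/poly_ind: p => [|p c IH].
  by rewrite rmorph0 !(lin0 e_lin) star0.
rewrite rmorphD rmorphM /= map_polyX map_polyC /= !(linD e_lin) starD !pevC.
rewrite starZ sa !eMX.
rewrite (cs_starM HA) IH sa -[in LHS]eMXl eMX //.
Qed.

Lemma e_normsq p : nA (e p) ^+ 2 = nA (e ('X * (conjp p * p))).
Proof. by rewrite -nA_cstar e_star eM. Qed.

Lemma e_ideal p q : e p = 0 -> e (p * q) = 0.
Proof.
move=> p0; rewrite -pev_pev; last exact: mul_linl.
elim/poly_ind: q => [|q c IH]; first by rewrite (lin0 (pev_lin _ _)).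
rewrite (linD (pev_lin _ _)) pevMX ?IH ?mul0x ?pevC ?p0 ?scaler0 ?addr0 //.
exact: mul_linl.
Qed.

Lemma conj_rpoly (p : {poly R}) : conjp (rpoly p) = rpoly p.
Proof.
rewrite -map_poly_comp; apply: eq_map_poly => t /=; exact: conjc_real.
Qed.

(* With n = p + i g one has |g n^2| = |g n n^*| by the C*-identity, and
   p^2 is the average of n^2, n^*^2 and twice n n^*. *)
Lemma e_mono (g p q : {poly R}) :
  nA (e (rpoly (g * p ^+ 2))) <= nA (e (rpoly (g * (p ^+ 2 + q ^+ 2)))).
Proof.
pose G := rpoly g; pose P := rpoly p; pose Q := rpoly q.
pose W : {poly C} := ('i : C)%:P.
have WW : W * W = -1 by rewrite -polyCM -expr2 sqr_i polyCN.
have conjW : conjp W = - W.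
  rewrite map_polyC /= -polyCN; congr (_%:P).
  by apply/eqP; rewrite eq_complex /= oppr0 !eqxx.
pose n := P + W * Q; pose m := P - W * Q.
have conjn : conjp n = m by rewrite rmorphD rmorphM /= conjW !conj_rpoly mulNr.
have conjm : conjp m = n.
  by rewrite rmorphB rmorphM /= conjW !conj_rpoly mulNr opprK.
have nm : n * m = P ^+ 2 + Q ^+ 2.
  rewrite (_ : n * m = P ^+ 2 - (W * W) * Q ^+ 2); last by rewrite /n /m; ring.
  by rewrite WW mulN1r opprK.
rewrite !(rmorphM, rmorphD, rmorphXn) /= -/G -/P -/Q -nm.
have sq_eq f : conjp f * f = (n * m) ^+ 2 ->
    nA (e (G * f)) = nA (e (G * (n * m))).
  move=> fE; apply/eqP; rewrite -(@eqrXn2 _ 2) ?nA_ge0 // !e_normsq; apply/eqP.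
  rewrite !rmorphM /= conjn conjm !conj_rpoly; congr (nA (e _)).
  transitivity ('X * G ^+ 2 * (conjp f * f)); first by rewrite /G; ring.
  by rewrite fE /G; ring.
have nn : nA (e (G * (n * n))) = nA (e (G * (n * m))).
  by apply: sq_eq; rewrite rmorphM /= conjn; ring.
have mm : nA (e (G * (m * m))) = nA (e (G * (n * m))).
  by apply: sq_eq; rewrite rmorphM /= conjm; ring.
have -> : G * P ^+ 2 = (4^-1 : R)%:C *: (G * (n * n) + G * (m * m)
     + (G * (n * m) + G * (n * m))).
  rewrite (_ : _ + _ = (4%:R : C) *: (G * P ^+ 2)); last first.
    by rewrite -mul_polyC polyC_natr /n /m; ring.
  by rewrite scalerA -(rmorph_nat (real_complex R)) -rmorphM mulVf ?scale1r //
     pnatr_eq0.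
rewrite (linZ e_lin) nAZr !(linD e_lin) ger0_norm ?invr_ge0 ?ler0n //.
rewrite ler_pdivrMl ?ltr0n //.
apply: (le_trans (nAD _ _)); apply: (le_trans (lerD (nAD _ _) (nAD _ _))).
by rewrite nn mm; lra.
Qed.

Lemma e_mono_scaled (t : R) (g p q : {poly R}) : 0 <= t ->
  nA (e (rpoly (g * p ^+ 2))) <= nA (e (rpoly (g * (p ^+ 2 + t *: q ^+ 2)))).
Proof.
move=> t0; have -> : t *: q ^+ 2 = (Num.sqrt t *: q) ^+ 2.
  by rewrite exprZn sqr_sqrtr.
exact: e_mono.
Qed.

Lemma e_normsq_real (p : {poly R}) :
  nA (e (rpoly p)) ^+ 2 = nA (e (rpoly (p ^+ 2 * 'X))).
Proof.
rewrite e_normsq conj_rpoly rmorphM rmorphXn /= map_polyX.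
by congr (nA (e _)); ring.
Qed.

(** By the C*-identity |a p(a)|^2 = |a p(a)^2 a|, so nilpotents cannot occur. *)
Lemma e_sqr_eq0 (p : {poly R}) : e (rpoly (p ^+ 2)) = 0 -> e (rpoly p) = 0.
Proof.
move=> p0; apply: nA_eq0; have := e_normsq_real p.
by rewrite rmorphM /= (e_ideal _ p0) nA0 => /eqP; rewrite sqrf_eq0 => /eqP ->.
Qed.

(** * Self-adjoint elements of norm one *)

Section NormOne.
Hypothesis a1 : nA a = 1.

Lemma e_contr n f : nA (e (f * 'X^n)) <= nA (e f).
Proof.
elim: n => [|n IH]; first by rewrite mulr1.
rewrite exprSr mulrA eMX; apply: le_trans IH.
by rewrite -[leRHS]mulr1 -a1 nAM.
Qed.

(** The lower bound propagates by the C*-identity: |a^(n+1)|^2 = |a^(2n+2)| <= |a^(n+2)|. *)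
Lemma e_Xn n : nA (e 'X^n) = 1.
Proof.
elim: n => [|n IH]; first by rewrite expr0 pev1.
apply: le_anti; have := e_contr 1 'X^n; rewrite expr1 -exprSr IH => -> /=.
rewrite -(expr1n _ 2) -IH e_normsq -(map_polyXn (real_complex R)) conj_rpoly.
rewrite map_polyXn (_ : 'X * ('X^n * 'X^n) = 'X^(n.+1) * 'X^n) ?e_contr //.
by rewrite exprS; ring.
Qed.

Lemma rpoly_1BXn n : rpoly (1 - 'X^n) = 1 - 'X^n.
Proof. by rewrite rmorphB rmorph1 /= map_polyXn. Qed.

Lemma e_1BXn n f : nA (e (f * (1 - 'X^n))) <= 2 * nA (e f).
Proof.
rewrite mulrBr mulr1 (linB e_lin); apply: (le_trans (nAB _ _)).
by have := e_contr n f; lra.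
Qed.

(* Averages of powers of X^4: they stay at least as large as a single power
   of X, by the inequality (1 + X^4m)/2 >= X^2m, while almost annihilating
   1 - X^4. *)
Definition avg k : {poly R} := \prod_(j < k) (2^-1 *: (1 + 'X^(4 * 2 ^ j))).

Lemma avgS k : avg k.+1 = avg k * (2^-1 *: (1 + 'X^(4 * 2 ^ k))).
Proof. by rewrite /avg big_ord_recr. Qed.

(** Each new factor doubles the exponent: (1 - u)(1 + u) = 1 - u^2. *)
Lemma avg_telescope k :
  (1 - 'X^4) * avg k = (2^-1) ^+ k *: (1 - 'X^(4 * 2 ^ k)).
Proof.
elim: k => [|k IH]; first by rewrite /avg big_ord0 mulr1 expr0 scale1r muln1.
rewrite avgS mulrA IH -scalerAl -scalerAr scalerA -exprSr; congr (_ *: _).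
have -> : 'X^(4 * 2 ^ k.+1) = 'X^(4 * 2 ^ k) ^+ 2 :> {poly R}.
  by rewrite -exprM -mulnA -expnSr.
by set u := 'X^(_); ring.
Qed.

Lemma e_avg_ge k g : exists m,
  nA (e (rpoly (g * 'X^m))) <= nA (e (rpoly (g * avg k))).
Proof.
elim: k g => [|k IH] g; first by exists 0%N; rewrite expr0 /avg big_ord0.
have [m hm] := IH (g * 'X^(2 ^ k) ^+ 2).
exists ((2 ^ k).*2 + m)%N; rewrite avgS.
have -> : 'X^((2 ^ k).*2 + m) = 'X^(2 ^ k) ^+ 2 * 'X^m :> {poly R}.
  by rewrite exprD -exprM muln2.
rewrite mulrA; apply: (le_trans hm).
have -> : g * 'X^(2 ^ k) ^+ 2 * avg k = (g * avg k) * 'X^(2 ^ k) ^+ 2 by ring.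
have h0 : 0 <= 2^-1 :> R by rewrite invr_ge0 ler0n.
(* With u = X^(2^k), the last factor (1 + u^4)/2 equals u^2 + (1 - u^2)^2/2. *)
apply: (le_trans (e_mono_scaled (g * avg k) 'X^(2 ^ k)
  (1 - 'X^(2 ^ k) ^+ 2) h0)).
rewrite le_eqVlt; apply/orP; left; apply/eqP; congr (nA (e (rpoly _))).
rewrite mulrA; congr (_ * _); rewrite (mulnC 4) exprM; set u := 'X^(2 ^ k).
have c2 : 2%:R * (2^-1 : R)%:P = 1 :> {poly R}.
  by rewrite -polyC_natr -polyCM mulfV ?pnatr_eq0.
rewrite -!mul_polyC; move: (_%:P) c2 => c c2.
transitivity ((2%:R * c) * u ^+ 2 + c * (1 - u ^+ 2) ^+ 2).
  by rewrite c2 mul1r.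
by ring.
Qed.

Lemma e_avg_contr k f : nA (e (f * rpoly (avg k))) <= nA (e f).
Proof.
elim: k => [|k IH]; first by rewrite /avg big_ord0 rmorph1 mulr1.
rewrite avgS rmorphM /= mulrA; apply: le_trans IH.
rewrite map_polyZ rmorphD rmorph1 /= map_polyXn -scalerAr (linZ e_lin) nAZr.
rewrite mulrDr mulr1 (linD e_lin) ger0_norm ?invr_ge0 ?ler0n //.
rewrite ler_pdivrMl ?ltr0n //; apply: (le_trans (nAD _ _)).
by have := e_contr (4 * 2 ^ k) (f * rpoly (avg k)); lra.
Qed.

(** Multiplying by [avg k] does not increase the norm, leaves the constant term with norm at least 1
    and shrinks the other term to at most 4 |l| / 2^k; then k grows. *)
Lemma e_perturb_ge1 (l : C) :
  1 <= nA (e (1 + l *: rpoly ((1 - 'X^4) ^+ 2))).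
Proof.
have main k : 1 - cabs l * (2 * (2 * (2^-1) ^+ k))
    <= nA (e (1 + l *: rpoly ((1 - 'X^4) ^+ 2))).
  apply: le_trans (e_avg_contr k _).
  rewrite [X in e X]mulrDl mul1r -[X in e (_ + X)]scalerAl.
  have [m hm] := e_avg_ge k 1.
  have {hm} h1 : 1 <= nA (e (rpoly (avg k))).
    by move: hm; rewrite !mul1r map_polyXn e_Xn.
  (* One factor 1 - X^4 telescopes against the average; the remaining one and the telescoped one
     cost a factor 2 each. *)
  have h2 : nA (e (rpoly ((1 - 'X^4) ^+ 2) * rpoly (avg k)))
      <= 2 * (2 * (2^-1) ^+ k).
    rewrite -rmorphM /= expr2 -mulrA avg_telescope -scalerAr map_polyZ /=.
    rewrite (linZ e_lin) nAZr ger0_norm ?exprn_ge0 ?invr_ge0 ?ler0n //.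
    rewrite !mulrA mulrC; apply: ler_wpM2r.
      by rewrite exprn_ge0 ?invr_ge0 ?ler0n.
    rewrite rmorphM /= !rpoly_1BXn; apply: (le_trans (e_1BXn _ _)).
    rewrite ler_pM2l ?ltr0n //.
    by have := e_1BXn 4 1; rewrite mul1r pev1 a1; lra.
  have := nAD (e (rpoly (avg k) + l *: (rpoly ((1 - 'X^4) ^+ 2) *
    rpoly (avg k)))) (- (e (l *: (rpoly ((1 - 'X^4) ^+ 2) * rpoly (avg k))))).
  rewrite -(linB e_lin) addrK nAN (linZ e_lin l) nAZ.
  by have := ler_wpM2l (cabs_ge0 l) h2; lra.
case: (lerP 1 (nA _)) => // lt1; exfalso.
set d := 1 - nA (e (1 + l *: rpoly ((1 - 'X^4) ^+ 2))).
have d0 : 0 < d by rewrite subr_gt0.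
have [k] : exists k, cabs l * 4 / d < 2 ^+ k.
  by exists (Num.bound (cabs l * 4 / d)); exact: upper_nthrootP.
rewrite ltr_pdivrMr // [_ ^+ k * d]mulrC -ltr_pdivrMr ?exprn_gt0 //.
rewrite -exprVn => hd.
move: (main k) hd; rewrite /d; move: (nA _) (2^-1 ^+ k) => v w; lra.
Qed.

(* For q = r^2 with r = 1 - X^4, the square 2 l (r (1 - r^2 / 4))^2 added to
   (q - l)^2 gives (1 - l) q^2 + l q^2 r^2 / 8 + l^2, of norm at most
   (1 - l / 2) |q^2| + l^2 since |r| <= 2. *)
Lemma e_shift_le (l : R) : 0 < l <= 1 ->
  nA (e (rpoly (((1 - 'X^4) ^+ 2 - l%:P) ^+ 2))) <=
  (1 - l / 2) * nA (e (rpoly (((1 - 'X^4) ^+ 2) ^+ 2))) + l ^+ 2.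
Proof.
move=> /andP[l0 l1]; set m := nA (e (rpoly (_ ^+ 2 ^+ 2))).
set r : {poly R} := 1 - 'X^4.
have l2 : 0 <= 2 * l by lra.
have := e_mono_scaled 1 (r ^+ 2 - l%:P) (r * (1 - 4^-1 *: r ^+ 2)) l2.
rewrite !mul1r => h; apply: (le_trans h) => {h}.
have -> : (r ^+ 2 - l%:P) ^+ 2 + (2 * l) *: (r * (1 - 4^-1 *: r ^+ 2)) ^+ 2
    = (1 - l) *: (r ^+ 2) ^+ 2 + ((2 * l * 4^-1 * 4^-1) *:
       ((r ^+ 2) ^+ 2 * r * r) + (l ^+ 2) *: 1).
  have c4 : 4%:R * (4^-1 : R)%:P = 1 :> {poly R}.
    by rewrite -polyC_natr -polyCM mulfV ?pnatr_eq0.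
  rewrite -!mul_polyC !(polyCM, polyCB, polyC1, polyC_exp) polyC_natr.
  move: (4^-1)%:P c4 => c c4; move: r => r.
  transitivity ((r ^+ 2 - l%:P) ^+ 2 + 2%:R * l%:P * r ^+ 2
    - (4%:R * c) * l%:P * r ^+ 4 + 2%:R * l%:P * c ^+ 2 * r ^+ 6); first ring.
  by rewrite c4; ring.
have re f : nA (e (rpoly (f * r))) <= 2 * nA (e (rpoly f)).
  by rewrite rmorphM /= rpoly_1BXn e_1BXn.
rewrite !rmorphD /= !map_polyZ rmorph1 !(linD e_lin) !(linZ e_lin) pev1 /=.
apply: (le_trans (nAD _ _)); apply: (le_trans (lerD (lexx _) (nAD _ _))).
rewrite !nAZr a1 mulr1 !ger0_norm ?sqr_ge0 ?subr_ge0 //; last by lra.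
have := le_trans (re _) (ler_wpM2l (ler0n _ 2) (re ((r ^+ 2) ^+ 2))).
have : 0 <= m by exact: nA_ge0.
rewrite -/m; move: (nA (e (rpoly (_ * _)))) => v.
move: m => m m0 hv; have := ler_wpM2l (ltW l0) hv; lra.
Qed.

(** With m the norm on the left, [e_shift_le] gives m <= (1 - l/2) m + l^2, so m <= 2 l for all
    small l and m = 0. Taking square roots twice leaves a (1 - a^4) = 0. *)
Lemma e_sqr_eq1 :
  (forall l : R, 0 < l <= 1 ->
    nA (e (rpoly (((1 - 'X^4) ^+ 2) ^+ 2))) <=
    nA (e (rpoly (((1 - 'X^4) ^+ 2 - l%:P) ^+ 2)))) ->
  e (rpoly ('X^2 - 1)) = 0.
Proof.
move=> h; have {h} m0 : e (rpoly (((1 - 'X^4) ^+ 2) ^+ 2)) = 0.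
  apply: nA_eq0; rewrite leNgt; apply/negP => m0.
  have [l [l0 lm]] : exists l : R, 0 < l <= 1 /\
      2 * l < nA (e (rpoly (((1 - 'X^4) ^+ 2) ^+ 2))).
    move: (nA _) m0 => m m0; case: (lerP 4 m) => m4.
      by exists 1; split; [rewrite ltr01 lexx | lra].
    by exists (m / 4); split; [apply/andP; split; lra | lra].
  have := le_trans (h l l0) (e_shift_le l0); case/andP: l0 => l0 _.
  move: (nA _) lm => m lm; have := ltr_pM2l l0 (2 * l) m; rewrite lm.
  by rewrite expr2; lra.
have r0 := e_sqr_eq0 (e_sqr_eq0 m0).
(* The positive factor 1 + X^2 is removed by monotonicity, as (X^2 - 1)^2 (1 + X^2) is a multiple of
   1 - X^4. *)
apply: e_sqr_eq0; apply: nA_eq0.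
have := e_mono 1 ('X^2 - 1) ('X * ('X^2 - 1)); rewrite !mul1r.
have -> : ('X^2 - 1) ^+ 2 + ('X * ('X^2 - 1)) ^+ 2
   = (1 - 'X^4) * (1 - 'X^2) :> {poly R} by ring.
have -> : e (rpoly ((1 - 'X^4) * (1 - 'X^2))) = 0.
  by rewrite rmorphM /= (e_ideal _ r0).
by rewrite nA0.
Qed.

End NormOne.
End SelfAdjointCalculus.

(* [E f] is f(h), the constants being multiples of the unit p of p A p. *)
Section CornerCalculus.
Variables p h : A.
Hypotheses (ph : p ** h = h) (hp : h ** p = h).
Hypotheses (pp : p ** p = p) (sp : star p = p) (sh : star h = h).
Local Notation E := (pev (mul^~ h) p).

Lemma corner_MX f : E (f * 'X) = E f ** h.
Proof. by rewrite pevMX //; exact: mul_linl. Qed.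

Lemma corner_unitr f : E f ** p = E f.
Proof.
elim/poly_ind: f => [|f c IH]; first by rewrite (lin0 (pev_lin _ _)) mul0x.
rewrite (linD (pev_lin _ _)) pevC corner_MX (linD (mul_linl _)).
by rewrite (linZ (mul_linl _)) pp -mulxA hp.
Qed.

Lemma cornerM f g : E f ** E g = E (f * g).
Proof.
rewrite (@pev_map _ _ _ (mul^~ h) (mul^~ h) (mul (E f))).
- by rewrite corner_unitr pev_pev //; exact: mul_linl.
- exact: mul_linl.
- exact: mul_linl.
- exact: mul_linr.
- by move=> u; rewrite mulxA.
Qed.

Lemma corner_MXl f : E (f * 'X) = h ** E f.
Proof.
transitivity (E 'X ** E f); first by rewrite cornerM mulrC.
by rewrite pevX ?ph //; exact: mul_linl.
Qed.

Lemma corner_star f : star (E f) = E (conjp f).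
Proof.
elim/poly_ind: f => [|f c IH].
  by rewrite rmorph0 !(lin0 (pev_lin _ _)) star0.
rewrite rmorphD rmorphM /= map_polyX map_polyC /= !(linD (pev_lin _ _)) starD.
by rewrite !pevC starZ sp corner_MX corner_MXl (cs_starM HA) IH sh.
Qed.

Lemma corner_star_real (f : {poly R}) : star (E (rpoly f)) = E (rpoly f).
Proof. by rewrite corner_star conj_rpoly. Qed.

End CornerCalculus.

(** * Birkhoff-James symmetry and the cube identity *)

Section HilbertModule.
Variables (X : lmodType C) (act : X -> A -> X) (ip : X -> X -> A).
Hypothesis HX : is_hilbert_module mul star nA act ip.
Local Notation nX := (hm_norm nA ip).

Lemma act_linr x : linear (act x).
Proof. by move=> k u v; rewrite (hm_actDr HX) (hm_actZr HX). Qed.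

Lemma act_linl b : linear (act^~ b).
Proof. by move=> k u v; rewrite /= (hm_actDl HX) (hm_actZl HX). Qed.

Lemma act_mul x a b : act x (a ** b) = act (act x a) b.
Proof. exact: (hm_actM HX). Qed.

Lemma ip_linr x : linear (ip x).
Proof. by move=> k u v; rewrite (hm_ipDr HX) (hm_ipZr HX). Qed.

Lemma ip_star x y : star (ip x y) = ip y x.
Proof. exact: (hm_ip_star HX). Qed.

Lemma ip_sa x : star (ip x x) = ip x x.
Proof. exact: ip_star. Qed.

Lemma ip_act x y b : ip x (act y b) = ip x y ** b.
Proof. exact: (hm_ip_act HX). Qed.

Lemma ip_actl x y b : ip (act x b) y = star b ** ip x y.
Proof. by rewrite -ip_star ip_act (cs_starM HA) ip_star. Qed.

Lemma ipDl x y z : ip (x + y) z = ip x z + ip y z.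
Proof. by rewrite -ip_star (linD (ip_linr z)) starD !ip_star. Qed.

Lemma ipZl k x z : ip (k *: x) z = cconj k *: ip x z.
Proof. by rewrite -ip_star (linZ (ip_linr z)) starZ ip_star. Qed.

Lemma ipZZ k x : ip (k *: x) (k *: x) = (k * cconj k) *: ip x x.
Proof. by rewrite ipZl (linZ (ip_linr x)) scalerA mulrC. Qed.

Lemma ip_eq0 x : ip x x = 0 -> x = 0.
Proof. exact: (hm_ip_def HX). Qed.

Lemma nX_sqr x : nX x ^+ 2 = nA (ip x x).
Proof. by rewrite sqr_sqrtr // nA_ge0. Qed.

Lemma nX_le x y : (nX x <= nX y) = (nA (ip x x) <= nA (ip y y)).
Proof. by rewrite ler_sqrt // nA_ge0. Qed.

Lemma ip_pev x y f b : ip y (pev (act^~ b) x f) = pev (mul^~ b) (ip y x) f.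
Proof.
apply: pev_map; [exact: act_linl|exact: mul_linl|exact: ip_linr|].
by move=> u; rewrite ip_act.
Qed.

Section SelfInnerProduct.
Variable x : X.
Local Notation a := (ip x x).
Local Notation e := (pev (mul^~ a) a).
Local Notation xp := (pev (act^~ a) x).

Lemma ip_xp f g : ip (xp f) (xp g) = e (conjp f * g).
Proof.
rewrite ip_pev -pev_pev; last exact: mul_linl.
by rewrite -[ip (xp f) x]ip_star ip_pev (e_star (ip_sa x)).
Qed.

(** The left side is |a f(a)^* f(a) a|, which has one more factor of the contraction a than the
    right side. *)
Lemma nA_e_le_xp f : nA a = 1 -> nA (e f) ^+ 2 <= nA (ip (xp f) (xp f)).
Proof.
move=> a1; rewrite (e_normsq (ip_sa x)) ip_xp mulrC -['X]expr1.
exact: (e_contr a1 1).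
Qed.

(** x + l x q(a) is x (1 + l q)(a), whose norm is at least |a (1 + l q)(a)| >= 1 = |x|. *)
Lemma bj_orth_xp : nA a = 1 ->
  bj_orth nA ip x (xp (rpoly ((1 - 'X^4) ^+ 2))).
Proof.
move=> a1 l; rewrite nX_le a1.
have -> : x + l *: xp (rpoly ((1 - 'X^4) ^+ 2)) =
   xp (1 + l *: rpoly ((1 - 'X^4) ^+ 2)).
  by rewrite (linD (pev_lin _ _)) (linZ (pev_lin _ _)) pev1.
apply: le_trans (nA_e_le_xp _ a1).
by rewrite expr_ge1 ?nA_ge0 // (e_perturb_ge1 (ip_sa x) a1).
Qed.

End SelfInnerProduct.

Section Symmetric.
Hypothesis symm : forall x y, bj_orth nA ip x y -> nX y <= nX (x + y).

(** Replacing x by k x turns [symm] into |y| <= |k x + y| for every k, that is, orthogonality in the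
    reverse order. *)
Lemma bj_orthZ k x y : bj_orth nA ip x y -> bj_orth nA ip (k *: x) y.
Proof.
have [->|k0] := eqVneq k 0.
  move=> _ l; rewrite nX_le scale0r (lin0 (ip_linr 0)) nA0; exact: nA_ge0.
move=> xy l; have := xy (k^-1 * l); rewrite !nX_le => h.
have -> : k *: x + l *: y = k *: (x + (k^-1 * l) *: y).
  by rewrite scalerDr scalerA mulVKf.
by rewrite !ipZZ !nAZ ler_wpM2l // cabs_ge0.
Qed.

(** Symmetry gives |x q(a)| <= |x (q - l)(a)|, the hypothesis of [e_sqr_eq1]. The resulting a (a^2 -
    1) = 0 also kills the inner square of x (a^2 - 1). *)
Lemma ip_cube_unit x : nA (ip x x) = 1 ->
  ip x x ** ip x x ** ip x x = ip x x /\ act x (ip x x ** ip x x) = x.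
Proof.
move=> a1; set a := ip x x.
have f0 : pev (mul^~ a) a (rpoly ('X^2 - 1)) = 0.
  apply: (e_sqr_eq1 (ip_sa x) a1) => l l01.
  have := symm (bj_orthZ (- l%:C) (bj_orth_xp a1)); rewrite nX_le.
  set q := (1 - 'X^4) ^+ 2.
  have -> : (- l%:C) *: x + pev (act^~ a) x (rpoly q) =
      pev (act^~ a) x (rpoly (q - l%:P)).
    rewrite rmorphB /= map_polyC /= (linB (pev_lin _ _)) pevC.
    by rewrite addrC scaleNr.
  by rewrite !ip_xp !conj_rpoly -!rmorphM -!expr2.
have X2 : rpoly ('X^2 - 1) = 'X * 'X - 1.
  by rewrite rmorphB rmorph1 /= map_polyXn expr2.
split.
  move: f0; rewrite X2 (linB (pev_lin _ _)) pev1 => /subr0_eq.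
  by rewrite !(eMX, pevX) //; exact: mul_linl.
have : pev (act^~ a) x (rpoly ('X^2 - 1)) = 0.
  apply: ip_eq0; rewrite ip_xp conj_rpoly; exact: e_ideal.
rewrite X2 (linB (pev_lin _ _)) pev1 => /subr0_eq.
by rewrite act_mul pevMX ?pevX //; exact: act_linl.
Qed.

Lemma unit_scale x : x <> 0 ->
  let t := (Num.sqrt (nA (ip x x)))^-1%:C in
  [/\ t != 0, nA (ip (t *: x) (t *: x)) = 1 &
      ip (t *: x) (t *: x) = (nA (ip x x))^-1%:C *: ip x x].
Proof.
move=> x0 t; have ap : 0 < nA (ip x x) by apply: nA_gt0 => /ip_eq0.
have eq : ip (t *: x) (t *: x) = (nA (ip x x))^-1%:C *: ip x x.
  rewrite ipZZ conjc_real -rmorphM -invfM -expr2 sqr_sqrtr //; exact: ltW.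
split=> //; last first.
  by rewrite eq nAZr ger0_norm ?invr_ge0 ?ltW // mulVf // gt_eqF.
by rewrite /t fmorph_eq0 invr_eq0 gt_eqF // sqrtr_gt0.
Qed.

Lemma ip_cube x :
  ip x x ** ip x x ** ip x x = (nA (ip x x) ^+ 2)%:C *: ip x x.
Proof.
have [->|/eqP x0] := eqVneq x 0.
  by rewrite (lin0 (ip_linr 0)) !mulx0 scaler0.
have [t0 n1 eq] := unit_scale x0.
have [+ _] := ip_cube_unit n1; rewrite eq; set n := nA _.
have n0 : n != 0 by rewrite gt_eqF //; apply: nA_gt0 => /ip_eq0.
rewrite !(cs_mulZl HA, cs_mulZr HA) !scalerA -!rmorphM /= => aaa.
have := congr1 (fun z => (n ^+ 3)%:C *: z) aaa; rewrite !scalerA -!rmorphM /=.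
rewrite (_ : n ^+ 3 * n^-1 = n ^+ 2); last by rewrite exprSr mulfK.
by rewrite (_ : n ^+ 3 * _ = 1) ?scale1r //; field.
Qed.

End Symmetric.

(** * Consequences of the cube identity *)

Section RankOne.
Hypothesis cube : forall x,
  ip x x ** ip x x ** ip x x = (nA (ip x x) ^+ 2)%:C *: ip x x.
Variable x : X.
Hypothesis x1 : nA (ip x x) = 1.
Local Notation a := (ip x x).
Local Notation p := (a ** a).
Hypothesis xp : act x p = x.

Lemma cube1 : a ** a ** a = a.
Proof. by rewrite cube x1 expr1n scale1r. Qed.

Lemma supp_star : star p = p.
Proof. by rewrite (cs_starM HA) !ip_sa. Qed.

Lemma supp_ip y : p ** ip x y = ip x y.
Proof. by rewrite -[in LHS]supp_star -ip_actl xp. Qed.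

Lemma supp_idem : p ** p = p.
Proof. by rewrite mulxA cube1. Qed.

Lemma supp_neq0 : p <> 0.
Proof.
move=> p0; have := supp_ip x; rewrite p0 mul0x => /esym a0.
by move: x1; rewrite a0 nA0 => /eqP; rewrite eq_sym oner_eq0.
Qed.

Lemma supp_scalar_inj (k : R) : k%:C *: p = 0 -> k = 0.
Proof.
move=> /eqP; rewrite scaler_eq0 => /orP[|/eqP/supp_neq0 //].
by rewrite fmorph_eq0 => /eqP.
Qed.

Lemma collect_scalars (u v u' v' : R) (b c : A) :
  u%:C *: c + v%:C *: b = u'%:C *: c + v'%:C *: b ->
  (v - v')%:C *: b = (u' - u)%:C *: c.
Proof.
rewrite !rmorphB !scalerBl => h.
have -> : v%:C *: b = u'%:C *: c + v'%:C *: b - u%:C *: c.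
  by rewrite -h [u%:C *: c + _]addrC addrK.
by rewrite addrAC addrK.
Qed.

Lemma supp_solve b (u v : R) : u%:C *: b = v%:C *: p -> u <> 0 ->
  b = (v / u)%:C *: p.
Proof.
move=> h /eqP u0; rewrite rmorphM /= mulrC -scalerA -h scalerA -rmorphM mulVf //.
by rewrite scale1r.
Qed.

Local Notation calc h f := (pev (mul^~ h) p (rpoly f)).

(** * Real polynomials in a self-adjoint element of the corner *)

Section RealPolynomials.
Variable h : A.
Hypotheses (hp : h ** p = h) (sh : star h = h).
Local Notation E f := (calc h f).

Lemma supp_sa_l : p ** h = h.
Proof. by rewrite -[in LHS]sh -[in LHS]supp_star -(cs_starM HA) hp sh. Qed.

Lemma cornerE_M f g : E f ** E g = E (f * g).
Proof. by rewrite cornerM ?supp_idem ?supp_sa_l // rmorphM. Qed.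

Lemma cornerE_C (u : R) f : E (u%:P * f) = u%:C *: E f.
Proof. by rewrite rmorphM /= map_polyC mul_polyC (linZ (pev_lin _ _)). Qed.

Lemma cornerE_affine (u v : R) f :
  E (u%:P + v%:P * f) = u%:C *: p + v%:C *: E f.
Proof.
by rewrite rmorphD (linD (pev_lin _ _)) cornerE_C /= map_polyC pevC.
Qed.

Lemma cornerE_sa f : star (E f) = E f.
Proof.
by apply: corner_star_real; rewrite ?supp_sa_l ?supp_idem ?supp_star.
Qed.

Lemma cornerE_unit f : E f ** p = E f.
Proof. by rewrite corner_unitr ?supp_idem. Qed.

Lemma cornerE_X : E 'X = h.
Proof. by rewrite map_polyX pevX ?supp_sa_l //; exact: mul_linl. Qed.

Lemma cornerE_MX f : E f ** h = E (f * 'X).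
Proof. by rewrite rmorphM /= map_polyX corner_MX. Qed.

(** Reduction modulo an annihilating polynomial d; the quotient w is supplied at each use. *)
Lemma cornerE_mod d f g w : E d = 0 -> f = g + d * w -> E f = E g.
Proof.
move=> d0 ->; rewrite rmorphD /= (linD (pev_lin _ _)) [E (d * w)](_ : _ = 0).
  by rewrite addr0.
by rewrite -cornerE_M d0 mul0x.
Qed.

End RealPolynomials.

(* Apply the cube identity to x (1 + 2 a). *)
Lemma supp_sign : exists2 k : R, k ^+ 2 = 1 & a = k%:C *: p.
Proof.
have ap : a ** p = a by rewrite mulxA cube1.
have sa := ip_sa x.
have d0 : calc a ('X^2 - 1) = 0.
  rewrite rmorphB rmorph1 /= map_polyXn (linB (pev_lin _ _)) pev1 expr2.
  rewrite corner_MX pevX /=; last exact: mul_linl.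
  by rewrite -mulxA supp_idem subrr.
(* With coefficient 1 instead of 2, <y, y> would be 2 (p + a), four times a projection, and the cube
   identity would say nothing new. *)
pose y := act x (calc a (1 + 2%:R * 'X)).
(* Modulo X^2 - 1, X (1 + 2 X)^2 is 4 + 5 X; its cube is 364 + 365 X. *)
have yy : ip y y = calc a (4%:P + 5%:P * 'X).
  rewrite ip_actl ip_act mulxA cornerE_sa // cornerE_MX.
  rewrite cornerE_M //; apply: (@cornerE_mod _ ap _ _ _ (4%:R + 4%:R * 'X) d0).
  by rewrite !polyC_natr; ring.
have := cube y; rewrite yy !cornerE_M //; set M := nA _ ^+ 2.
have -> : calc a ((4%:P + 5%:P * 'X) * (4%:P + 5%:P * 'X) * (4%:P + 5%:P * 'X))
   = calc a (364%:P + 365%:P * 'X).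
  apply: (@cornerE_mod _ ap _ _ _ (300%:R + 125%:R * 'X) d0).
  by rewrite !polyC_natr; ring.
rewrite !cornerE_affine // cornerE_X // scalerDr !scalerA -!rmorphM /= => eq.
have {}eq : (365 - M * 5)%:C *: a = (M * 4 - 364)%:C *: p.
  exact: collect_scalars.
(* Otherwise M = 73 and the right side is -72 p, which is nonzero. *)
have nz : 365 - M * 5 <> 0.
  move=> M0; move: eq; rewrite M0 scale0r => /esym/supp_scalar_inj; lra.
have ak := supp_solve eq nz; move: (_ / _) ak => k ak; exists k => //.
have pk : p = (k ^+ 2)%:C *: p.
  transitivity ((k%:C *: p) ** (k%:C *: p)); first by rewrite -ak.
  by rewrite (cs_mulZl HA) (cs_mulZr HA) supp_idem scalerA -rmorphM expr2.
apply/subr0_eq/supp_scalar_inj.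
by rewrite rmorphB scalerBl -pk rmorph1 scale1r subrr.
Qed.

(** * The corner consists of scalars *)

(** The inner square of x h is h a h = k h^2 with k = +-1, and the sign cancels in its cube
    identity. *)
Lemma corner_six h : h ** p = h -> star h = h ->
  (h ** h) ** (h ** h) ** (h ** h) = (nA h ^+ 4)%:C *: (h ** h).
Proof.
move=> hp sh; have [k k1 ak] := supp_sign.
have hh : ip (act x h) (act x h) = k%:C *: (h ** h).
  by rewrite ip_actl ip_act ak sh (cs_mulZl HA) (cs_mulZr HA) supp_sa_l.
have := cube (act x h); rewrite hh nAZr.
have -> : nA (h ** h) = nA h ^+ 2 by rewrite -{1}sh nA_cstar.
rewrite !(cs_mulZl HA, cs_mulZr HA) !scalerA -!rmorphM /=.
have k2 : `|k| ^+ 2 = 1 by rewrite real_normK ?num_real.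
rewrite exprMn k2 mul1r -exprM (_ : k * k * k = k); last first.
  by rewrite -expr2 k1 mul1r.
move=> /(congr1 ( *:%R k%:C)); rewrite !scalerA -!rmorphM /= [k * (_ * k)]mulrCA.
by rewrite -expr2 k1 mulr1 scale1r.
Qed.

(** With d = X^2 - n^2, [corner_six] says that X d (X^2 + n^2) is annihilated by [e]. The
    C*-identity removes X at the cost of squaring d, monotonicity removes X^2 + n^2, and the
    C*-identity removes the square. *)
Lemma corner_cube h : h ** p = h -> star h = h ->
  h ** h ** h = (nA h ^+ 2)%:C *: h.
Proof.
move=> hp sh; have [->|/eqP h0] := eqVneq h 0; first by rewrite !mulx0 scaler0.
have n0 : 0 < nA h by exact: nA_gt0.
have := corner_six hp sh; move: (nA h) n0 => n n0.
pose e f := pev (mul^~ h) h (rpoly f).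
have eM' f g : e f ** e g = e ('X * (f * g)).
  by rewrite /e eM !rmorphM /= map_polyX.
have eX : e 'X = h ** h by rewrite /e map_polyX pevX //; exact: mul_linl.
have eC c f : e (c%:P * f) = c%:C *: e f.
  by rewrite /e rmorphM /= map_polyC mul_polyC (linZ (pev_lin _ _)).
have eB f g : e (f - g) = e f - e g by rewrite /e rmorphB /= (linB (pev_lin _ _)).
have eI f g : e f = 0 -> e (f * g) = 0.
  by move=> f0; rewrite /e rmorphM /= e_ideal.
rewrite -eX !eM' -eC => /eqP; rewrite -subr_eq0 -eB => /eqP six.
pose d : {poly R} := 'X^2 - (n ^+ 2)%:P.
have dk : e (d ^+ 2 * ('X^2 + (n ^+ 2)%:P)) = 0.
  apply: nA_eq0; set k := _ * _; have := e_normsq_real sh k; rewrite -!/(e _).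
  have -> : k ^+ 2 * 'X = ('X * ('X * ('X * 'X) * 'X) - (n ^+ 4)%:P * 'X) *
      (d * k) by rewrite /k /d !polyC_exp; ring.
  by rewrite (eI _ _ six) nA0 => /eqP; rewrite sqrf_eq0 => /eqP ->.
have d0 : e (n%:P * d) = 0.
  apply: e_sqr_eq0 => //; apply: nA_eq0.
  have := e_mono sh 1 (n%:P * d) ('X * d); rewrite !mul1r -!/(e _).
  rewrite (_ : _ + _ = d ^+ 2 * ('X^2 + (n ^+ 2)%:P)) ?dk ?nA0 //.
  by rewrite polyC_exp; ring.
move: d0; rewrite eC => /eqP; rewrite scaler_eq0 fmorph_eq0 gt_eqF //= => /eqP.
rewrite eB -[(n ^+ 2)%:P]mulr1 eC /e rmorph1 pev1 map_polyXn expr2 => /subr0_eq.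
by rewrite map_polyX pevMX ?pevX //; exact: mul_linl.
Qed.

(* The corner p A p is spanned by p: the cube identity for |h|^2 p + h^2
   forces h^2 to be a multiple of p, and then so does (p + h)^2 for h. *)
Lemma corner_sqr_scalar h : h ** p = h -> star h = h ->
  exists k : R, h ** h = k%:C *: p.
Proof.
move=> hp sh; have [->|/eqP h0] := eqVneq h 0.
  by exists 0; rewrite mulx0 scale0r.
have n0 : 0 < nA h by exact: nA_gt0.
have := corner_cube hp sh; set n := nA h ^+ 2 => h3.
have n1 : 0 < n by rewrite exprn_gt0.
pose c := calc h (n%:P + 1%:P * 'X^2).
have hh : calc h 'X^2 = h ** h.
  by rewrite expr2 -cornerE_MX cornerE_X.
have d0 : calc h ('X^2 * 'X - n%:P * 'X) = 0.
  rewrite rmorphB (linB (pev_lin _ _)) -cornerE_MX hh h3.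
  by rewrite cornerE_C cornerE_X // subrr.
have := @corner_cube c (cornerE_unit hp _) (cornerE_sa hp sh _).
rewrite !cornerE_M //; set M := nA _ ^+ 2.
(* By h^3 = n h, the fourth and sixth powers become n X^2 and n^2 X^2, so (n + X^2)^3 reduces to n^3
   + 7 n^2 X^2. *)
rewrite (@cornerE_mod _ hp _ _ ((n ^+ 3)%:P + (7 * n ^+ 2)%:P * 'X^2)
  ('X * ('X^2 + 4%:R * n%:P)) d0); last first.
  by rewrite !(polyCM, polyC_exp) polyC_natr; ring.
rewrite /c !cornerE_affine // hh scalerDr !scalerA -!rmorphM /=.
(* If the coefficient 7 n^2 - M of h^2 vanished, the equation would read 6 n^3 p = 0. *)
move=> /collect_scalars eq; eexists; apply: (supp_solve eq) => {hh d0} M0.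
have n3 : 0 < n ^+ 3 by rewrite exprn_gt0.
suff : M * n - n ^+ 3 = 0.
  have -> : M * n = 7 * n ^+ 3 by rewrite (exprSr n 2); nra.
  lra.
by apply: supp_scalar_inj; rewrite -eq M0 scale0r.
Qed.

Lemma corner_sa_scalar h : h ** p = h -> star h = h ->
  exists k : R, h = k%:C *: p.
Proof.
move=> hp sh; have [k hk] := corner_sqr_scalar hp sh.
have [||l] := @corner_sqr_scalar (p + h).
- by rewrite (linD (mul_linl _)) supp_idem hp.
- by rewrite starD supp_star sh.
rewrite (linD (mul_linl _)) !(linD (mul_linr _)) supp_idem hp hk supp_sa_l //.
move=> eq; exists ((l - k - 1) / 2); apply: supp_solve; last by lra.
rewrite !rmorphB !scalerBl -eq rmorph1 scale1r.
rewrite (rmorph_nat (real_complex R) 2) scaler_nat mulr2n.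
by rewrite !addrA addrK -(addrA p) [p + _]addrC addrK.
Qed.

(** The real and imaginary parts of p b p are self-adjoint elements of the corner. *)
Lemma corner_scalar b : exists c : C, p ** b ** p = c *: p.
Proof.
set d := p ** b ** p.
have dp : d ** p = d by rewrite -mulxA supp_idem.
have sd : star d = p ** star b ** p.
  by rewrite (cs_starM HA (p ** b)) (cs_starM HA p) supp_star mulxA.
have sdp : star d ** p = star d by rewrite sd -mulxA supp_idem.
have [|| u hu] := @corner_sa_scalar (d + star d).
- by rewrite (linD (mul_linl _)) dp sdp.
- by rewrite starD (cs_starK HA) addrC.
have [|| v hv] := @corner_sa_scalar ('i *: (d - star d)).
- by rewrite (cs_mulZl HA) (linB (mul_linl _)) dp sdp.
- rewrite starZ starD starN (cs_starK HA) -[star d - d]opprB scalerN -scaleNr.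
  by congr (_ *: _); apply/eqP; rewrite eq_complex /= oppr0 opprK !eqxx.
exists (2^-1 * (u%:C - 'i * v%:C)).
have -> : d = 2^-1 *: ((d + star d) - 'i *: ('i *: (d - star d))).
  rewrite scalerA -expr2 sqr_i scaleN1r opprK addrACA addrN addr0 -mulr2n.
  by rewrite -(scaler_nat 2 d) scalerA mulVf ?scale1r // pnatr_eq0.
by rewrite hu hv scalerA -scalerBl scalerA.
Qed.

(** * Orthogonal complements and expansion along x *)

Lemma cube_orth_sum u v : u ** v = 0 -> v ** u = 0 ->
  (u + v) ** (u + v) ** (u + v) = u ** u ** u + v ** v ** v.
Proof.
move=> uv vu.
rewrite (linD (mul_linl (u + v))) !(linD (mul_linr _)) uv vu addr0 add0r.
rewrite !(linD (mul_linl _)) -!mulxA uv vu !mulx0 addr0 add0r.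
by rewrite !mulxA.
Qed.

Lemma supp_ip_orth y : act y p = 0 -> ip y y ** p = 0 /\ p ** ip y y = 0.
Proof.
move=> yp; split; first by rewrite -ip_act yp (lin0 (ip_linr y)).
by rewrite -[in LHS]supp_star -ip_actl yp -ip_star (lin0 (ip_linr y)) star0.
Qed.

(* The cube identity for x + t w forces t^6 g^3 = t^2 g with g = <w, w>. *)
Lemma supp_compl_orth w : act w p = 0 -> ip x w = 0 -> w = 0.
Proof.
move=> wp xw; have [gp pg] := supp_ip_orth wp; set g := ip w w in gp pg.
have ag : a ** g = 0 by rewrite -cube1 -(mulxA a a a) -(mulxA a p g) pg mulx0.
have ga : g ** a = 0 by rewrite -cube1 mulxA gp mul0x.
have wx : ip w x = 0 by rewrite -ip_star xw star0.
have eq t : (t ^+ 6)%:C *: (g ** g ** g) = (t ^+ 2)%:C *: g.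
  have := cube (x + t%:C *: w).
  have -> : ip (x + t%:C *: w) (x + t%:C *: w) = a + (t ^+ 2)%:C *: g.
    rewrite ipDl !(linD (ip_linr _)) !(linZ (ip_linr _)) !ipZl xw wx.
    by rewrite !scaler0 addr0 add0r scalerA conjc_real -rmorphM.
  rewrite cube_orth_sum; last 2 first.
  - by rewrite (cs_mulZr HA) ag scaler0.
  - by rewrite (cs_mulZl HA) ga scaler0.
  rewrite cube1 !(cs_mulZl HA, cs_mulZr HA) !scalerA -!rmorphM /=.
  move: (nA _ ^+ 2) => M eqM.
  (* Multiplication by a annihilates g and leaves p = M p. *)
  have M1 : M = 1.
    have := congr1 (mul a) eqM.
    rewrite !(linD (mul_linr _), linZ (mul_linr _)) !mulxA ag !mul0x !scaler0.
    rewrite !addr0 -{1}[p]scale1r -(rmorph1 (real_complex R)) => /eqP.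
    by rewrite -subr_eq0 -scalerBl -rmorphB => /eqP/supp_scalar_inj/subr0_eq.
  by move: eqM; rewrite M1 scale1r => /addrI; rewrite -!exprD => <-.
(* t = 1 gives g^3 = g; then t = 2 gives 64 g = 4 g. *)
have eq1 : g ** g ** g = g by have := eq 1; rewrite !expr1n !scale1r.
have := eq 2; rewrite eq1 => /eqP; rewrite -subr_eq0 -scalerBl.
rewrite -rmorphB scaler_eq0 fmorph_eq0 (_ : _ - _ = 60%:R); last by ring.
by rewrite pnatr_eq0 => /eqP/ip_eq0.
Qed.

(** k x <x, z> is the component of z along x, because <x, x> <x, z> = k <x, z> and k^2 = 1. *)
Lemma resid_orth k z : k ^+ 2 = 1 -> a = k%:C *: p ->
  ip x (z - k%:C *: act x (ip x z)) = 0.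
Proof.
move=> k1 ak; rewrite (linB (ip_linr _)) (linZ (ip_linr _)) ip_act.
rewrite [a ** _](_ : _ = k%:C *: ip x z).
  by rewrite scalerA -rmorphM -expr2 k1 scale1r subrr.
by rewrite {1}ak (cs_mulZl HA) supp_ip.
Qed.

Lemma resid_supp k z : k ^+ 2 = 1 -> a = k%:C *: p -> act z p = 0 ->
  z = k%:C *: act x (ip x z).
Proof.
move=> k1 ak zp; apply: subr0_eq; apply: supp_compl_orth; last exact: resid_orth.
rewrite (linB (act_linl _)) (linZ (act_linl _)) zp -act_mul -ip_act zp.
by rewrite (lin0 (ip_linr _)) (lin0 (act_linr _)) scaler0 subr0.
Qed.

Lemma act_supp_idem z : act (act z p) p = act z p.
Proof. by rewrite -act_mul supp_idem. Qed.

Lemma compress_ip y z : act y p = y -> act z p = z ->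
  p ** ip y z ** p = ip y z.
Proof.
by move=> yp zp; rewrite -[in LHS]supp_star -ip_actl supp_star -ip_act yp zp.
Qed.

(** y b vanishes by [supp_compl_orth]. Since <y, y> = c p, this reads c b^* b = 0, and b is nonzero,
    so c = 0. *)
Lemma supp_left_unique b y : p ** b = b -> b ** p = 0 -> b <> 0 ->
  act y p = y -> ip x y = 0 -> y = 0.
Proof.
move=> pb bp b0 yp xy; have yb0 : act y b = 0.
  apply: supp_compl_orth; first by rewrite -act_mul bp (lin0 (act_linr _)).
  by rewrite ip_act xy mul0x.
have [c] := corner_scalar (ip y y).
rewrite compress_ip // => yy.
have [c0|c0] := eqVneq c 0; first by apply: ip_eq0; rewrite yy c0 scale0r.
have : ip (act y b) (act y b) = c *: (star b ** b).
  by rewrite ip_actl ip_act yy (cs_mulZl HA) (cs_mulZr HA) pb.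
rewrite yb0 (lin0 (ip_linr 0)) => /esym/eqP; rewrite scaler_eq0.
by rewrite (negPf c0) => /eqP/star_mul_eq0 /b0.
Qed.

(** z p and z - z p are expanded separately, by [supp_left_unique] and by [resid_supp]. *)
Lemma rank_one_expand k b z : k ^+ 2 = 1 -> a = k%:C *: p ->
  p ** b = b -> b ** p = 0 -> b <> 0 -> z = k%:C *: act x (ip x z).
Proof.
move=> k1 ak pb bp b0; have zp : act z p = k%:C *: act x (ip x (act z p)).
  apply/subr0_eq; apply: (supp_left_unique pb bp b0); last exact: resid_orth.
  rewrite (linB (act_linl _)) (linZ (act_linl _)) -[act (act x _) p]act_mul.
  by rewrite -(ip_act x (act z p) p) !act_supp_idem.
have wp : z - act z p = k%:C *: act x (ip x (z - act z p)).
  by apply: resid_supp => //; rewrite (linB (act_linl _)) act_supp_idem subrr.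
have := congr2 +%R wp zp; rewrite subrK -scalerDr -(linD (act_linr _)).
by rewrite -(linD (ip_linr _)) subrK.
Qed.

(** * Construction of the isomorphisms with the scalars *)

Lemma supp_norm1 : nA p = 1.
Proof.
have [k k1 ak] := supp_sign.
have k1' : `|k| = 1 by apply/eqP; rewrite -sqrp_eq1 // real_normK ?num_real ?k1.
by have := x1; rewrite {1}ak nAZr k1' mul1r.
Qed.

Lemma nA_compress b : nA (p ** b ** p) <= nA b.
Proof.
apply: le_trans (nAM _ _) _; rewrite supp_norm1 mulr1.
by apply: le_trans (nAM _ _) _; rewrite supp_norm1 mul1r.
Qed.

Lemma supp_scalar_injC (c d : C) : c *: p = d *: p -> c = d.
Proof.
move=> /eqP; rewrite -subr_eq0 -scalerBl scaler_eq0 => /orP[|/eqP/supp_neq0 //].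
by rewrite subr_eq0 => /eqP.
Qed.

(** All inner products lie in C p, which is a closed two-sided ideal; fullness makes it all of A. *)
Lemma full_support_iso : full_module mul nA ip ->
  (forall z, act z p = z) -> cstar_iso_C mul star.
Proof.
move=> full zp; have [k k1 ak] := supp_sign.
have ipp y z : exists c : C, ip y z = c *: p.
  have [c hc] := corner_scalar (ip y z); exists c.
  by rewrite -hc compress_ip.
(* <x, x d> = a d = k p d is an inner product, hence a multiple of p. *)
have pd d : exists c : C, p ** d = c *: p.
  have [c hc] := ipp x (act x d); exists (k%:C * c); rewrite -scalerA -hc ip_act.
  rewrite {3}ak (cs_mulZl HA) scalerA -rmorphM -expr2 k1 scale1r //.
have dp d : exists c : C, d ** p = c *: p.
  have [c hc] := pd (star d); exists (cconj c).
  by rewrite -[p in RHS]supp_star -starZ -hc (cs_starM HA) supp_star (cs_starK HA).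
have ideal : is_two_sided_ideal mul (fun b => exists c : C, b = c *: p).
  split.
  - by exists 0; rewrite scale0r.
  - by move=> _ _ [c ->] [d ->]; exists (c + d); rewrite scalerDl.
  - by move=> l _ [c ->]; exists (l * c); rewrite scalerA.
  - move=> _ b [c ->]; rewrite (cs_mulZl HA) (cs_mulZr HA).
    have [d ->] := pd b; have [d' ->] := dp b.
    by split; [exists (c * d) | exists (c * d')]; rewrite scalerA.
have span b : exists c : C, b = c *: p.
  have [c hc] := corner_scalar b; exists c; rewrite -hc.
  apply/subr0_eq; apply: nA_eq0; rewrite leNgt; apply/negP => gt0.
  have [d [/(_ _ ideal ipp)[l ->]]] := full b (nA (b - p ** b ** p) / 2)
    (divr_gt0 gt0 (ltr0n _ 2)).
  apply/negP; rewrite -leNgt.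
  (* Compression by p is contractive and fixes l p, so b is at most twice as far from its
     compression as from l p. *)
  rewrite (_ : b - p ** b ** p = (b - l *: p) - p ** (b - l *: p) ** p).
    by have := nAB (b - l *: p) (p ** (b - l *: p) ** p);
      have := nA_compress (b - l *: p); lra.
  rewrite (linB (mul_linr _)) (linB (mul_linl _)) (cs_mulZr HA) (cs_mulZl HA).
  by rewrite !supp_idem opprB addrA subrK.
pose phi b := projT1 (cid (span b)).
have phiE b : b = phi b *: p by rewrite /phi; case: cid.
have phiP b c : b = c *: p -> phi b = c.
  by move=> bc; apply: supp_scalar_injC; rewrite -phiE.
exists phi; split.
- by move=> b d bd; rewrite (phiE b) (phiE d) bd.
- by move=> c; exists (c *: p); exact: phiP.
- move=> l b d; apply: phiP; rewrite {1}(phiE b) {1}(phiE d).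
  by rewrite scalerA -scalerDl.
- move=> b d; apply: phiP; rewrite {1}(phiE b) {1}(phiE d).
  by rewrite (cs_mulZl HA) (cs_mulZr HA) supp_idem scalerA.
- by move=> b; apply: phiP; rewrite {1}(phiE b) starZ supp_star.
Qed.

(** The expansion makes every [theta] a scalar, hence also every limit of combinations; conversely
    the scalar c is c k theta_{x,x}. *)
Lemma expand_compact_iso k : k ^+ 2 = 1 ->
  a = k%:C *: p -> (forall z, z = k%:C *: act x (ip x z)) ->
  compact_iso_C nA act ip.
Proof.
move=> k1 ak exp.
have kC : k%:C * k%:C = 1 :> C by rewrite -rmorphM -expr2 k1 rmorph1.
have absk : `|k| = 1 by apply/eqP; rewrite -sqrp_eq1 // real_normK ?num_real ?k1.
have x0 : x <> 0.
  by move=> x0; apply: supp_neq0; rewrite x0 (lin0 (ip_linr 0)) mulx0.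
have xinj (c d : C) : c *: x = d *: x -> c = d.
  move=> /eqP; rewrite -subr_eq0 -scalerBl scaler_eq0 => /orP[|/eqP/x0 //].
  by rewrite subr_eq0 => /eqP.
have norm z : nX z = nA (ip x z).
  apply/eqP; rewrite -(@eqrXn2 _ 2) ?nA_ge0 ?sqrtr_ge0 // nX_sqr {2}(exp z).
  rewrite (linZ (ip_linr z)) ip_act nAZr absk mul1r.
  by rewrite -[X in X ** _]ip_star nA_cstar.
(* Expanding u and z gives u <v, z> = x (<x, u> <v, x>) <x, z>, and the bracket lies in the
   corner. *)
have theta_scalar u v : exists c : C, forall z, theta act ip u v z = c *: z.
  have [c hc] := corner_scalar (ip x u ** ip v x).
  have {}hc : ip x u ** ip v x = c *: p.
    by rewrite -hc (mulxA p) supp_ip -(mulxA (ip x u)) -(ip_act v x p) xp.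
  exists (k%:C * c) => z; rewrite /theta {1}(exp u) {1}(exp z).
  rewrite (linZ (ip_linr v)) ip_act (linZ (act_linl _)) (linZ (act_linr _)).
  rewrite scalerA kC scale1r -act_mul mulxA hc (cs_mulZl HA) supp_ip.
  by rewrite (linZ (act_linr x)) {2}(exp z) !scalerA mulrAC kC mul1r.
have comb_scalar s : exists c : C, forall z, theta_comb act ip s z = c *: z.
  elim: s => [|[[l u] v] s [c hc]].
    by exists 0 => z; rewrite /theta_comb big_nil scale0r.
  have [d hd] := theta_scalar u v; exists (l * d + c) => z.
  rewrite /theta_comb big_cons /= hd scalerA scalerDl; congr (_ + _).
  exact: hc.
have compact_scalar T : compact_ops nA act ip T ->
    exists c : C, forall z, T z = c *: z.
  move=> KT; have [c hc] := corner_scalar (ip x (T x)).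
  exists (k%:C * c) => z; apply/subr0_eq.
  suff small : ip x (T z - (k%:C * c) *: z) = 0.
    by rewrite (exp (_ - _)) small (lin0 (act_linr x)) scaler0.
  apply: nA_eq0; rewrite leNgt; apply/negP => gt0.
  (* Two errors of size e |z| arise, from approximating T at z and from comparing the scalars at x;
     their sum stays below n. *)
  set n := nA _ in gt0; pose e := n / (2 * (1 + nX z)).
  have nz : 0 < 2 * (1 + nX z) by have := sqrtr_ge0 (nA (ip z z)); rewrite -/(nX z); lra.
  have [s hs] := KT e (divr_gt0 gt0 nz); have [d hd] := comb_scalar s.
  have close : cabs (d - k%:C * c) <= e.
    have := hs x; rewrite hd !norm x1 mulr1 => h.
    have := le_trans (nA_compress _) h.
    rewrite (linB (ip_linr _)) (linZ (ip_linr _)) (linB (mul_linr _)).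
    rewrite (linB (mul_linl _)) hc (cs_mulZr HA) (cs_mulZl HA) supp_ip.
    rewrite (mulxA a a a) cube1 [X in _ - d *: X]ak scalerA -scalerBl nAZ.
    rewrite supp_norm1 mulr1 -[c - _]mul1r -kC -mulrA Normc.normcM cabs_real absk.
    by rewrite mul1r mulrBr mulrCA kC mulr1 -cabsN opprB.
  have h : nA (ip x (T z - d *: z)) <= e * nX z.
    by have := hs z; rewrite hd (norm (T z - d *: z)).
  have : n <= nA (ip x (T z - d *: z)) + cabs (d - k%:C * c) * nX z.
    rewrite norm -nAZ -(linZ (ip_linr _)); apply: le_trans (nAD _ _).
    by rewrite -(linD (ip_linr _)) scalerBl addrA subrK.
  have := ler_wpM2r (sqrtr_ge0 (nA (ip z z))) close; rewrite -/(nX z).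
  have : n = e * (2 * (1 + nX z)) by rewrite /e divfK // gt_eqF.
  have : 0 < e by exact: divr_gt0.
  move: (nA (ip x (T z - d *: z))) (cabs _) h gt0 => u v.
  by clearbody e n; move: (nX z) => w; nra.
have scalar_compact c : compact_ops nA act ip (fun z => c *: z).
  move=> e e0; exists [:: (c * k%:C, x, x)] => z.
  rewrite /theta_comb big_cons big_nil /= addr0 /theta -scalerA -exp subrr.
  rewrite norm (lin0 (ip_linr _)) nA0 mulr_ge0 ?sqrtr_ge0 //; exact: ltW.
(* phi is defined on all functions, but its value is constrained only on scalar operators. *)
have choice (T : X -> X) : exists c : C,
    (exists d : C, forall z, T z = d *: z) -> forall z, T z = c *: z.
  by have [[c hc]|nc] := pselect (exists d : C, forall z, T z = d *: z);
    [exists c | exists 0].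
pose phi T := projT1 (cid (choice T)).
have phiP T c : (forall z, T z = c *: z) -> phi T = c.
  move=> Tc; rewrite /phi; case: cid => d /= hd; apply: xinj.
  by rewrite -hd; [rewrite Tc | exists c].
exists phi; split.
- move=> S T /compact_scalar[c hc] /compact_scalar[d hd].
  rewrite (phiP _ _ hc) (phiP _ _ hd) => cd.
  by apply: functional_extensionality_dep => z; rewrite hc hd cd.
- by move=> c; exists (fun z => c *: z); split; [exact: scalar_compact | exact: phiP].
- move=> l S T /compact_scalar[c hc] /compact_scalar[d hd].
  rewrite (phiP _ _ hc) (phiP _ _ hd); apply: phiP => z.
  by rewrite hc hd scalerA -scalerDl.
- move=> S T /compact_scalar[c hc] /compact_scalar[d hd].
  rewrite (phiP _ _ hc) (phiP _ _ hd); apply: phiP => z.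
  by rewrite hc hd scalerA.
- move=> S T /compact_scalar[c hc] /compact_scalar[d hd] adj.
  rewrite (phiP _ _ hc) (phiP _ _ hd); have := adj x x.
  rewrite hc hd ipZl (linZ (ip_linr x)) => /esym/eqP.
  rewrite -subr_eq0 -scalerBl scaler_eq0 => /orP[|/eqP/ip_eq0/x0 //].
  by rewrite subr_eq0 => /eqP.
Qed.

(** If z p differs from z, then w = z - z p is nonzero with w p = 0, and b = <x, w> is nonzero
    because w = k x b. *)
Lemma rank_one_iso : full_module mul nA ip ->
  cstar_iso_C mul star \/ compact_iso_C nA act ip.
Proof.
move=> full; have [zp|] := pselect (forall z, act z p = z).
  by left; exact: full_support_iso.
move=> /existsNP[z zp]; right; have [k k1 ak] := supp_sign.
apply: (expand_compact_iso k1 ak) => y.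
have wp : act (z - act z p) p = 0.
  by rewrite (linB (act_linl _)) act_supp_idem subrr.
apply: (@rank_one_expand k (ip x (z - act z p))) => //.
- exact: supp_ip.
- by rewrite -ip_act wp (lin0 (ip_linr x)).
move=> b0; apply: zp; apply/esym/subr0_eq.
by rewrite (resid_supp k1 ak wp) b0 (lin0 (act_linr x)) scaler0.
Qed.

End RankOne.
Lemma nX_eq0 u : nX u = 0 -> u = 0.
Proof.
by move=> u0; apply: ip_eq0; apply: nA_eq0; rewrite -nX_sqr u0 expr0n.
Qed.

(* The norm comes from the scalar form B, which is definite but may be
   negative: a change of sign would produce an isotropic vector. *)
(** * Modules whose norm comes from a scalar form *)

Section ScalarForm.
Variable B : X -> X -> C.
Hypotheses (B_lin : forall u k v w, B u (k *: v + w) = k * B u v + B u w)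
  (B_herm : forall u v, B v u = cconj (B u v))
  (B_norm : forall u, cabs (B u u) = nX u ^+ 2).

Lemma form0 z : B z 0 = 0.
Proof. by have := B_lin z (-1) 0 0; rewrite scaler0 addr0 mulN1r addNr. Qed.

Lemma form_expand l u v : B (u + l *: v) (u + l *: v) =
  B u u + l * B u v + cconj (l * B u v) + l * cconj l * B v v.
Proof.
have lin z : B z (u + l *: v) = l * B z v + B z u by rewrite addrC B_lin.
rewrite lin (B_herm v) (B_herm u (_ + _)) !lin (B_herm v u).
rewrite !(rmorphD, rmorphM) /= conjcK -(B_herm u u) -(B_herm v v).
by ring.
Qed.

Local Notation re := (@complex.Re R).

Lemma form_real u : B u u = (re (B u u))%:C.
Proof.
have := B_herm u u; case: (B u u) => s t /= [] tt; congr Complex; lra.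
Qed.

Lemma form_norm u : `|re (B u u)| = nX u ^+ 2.
Proof. by rewrite -B_norm form_real cabs_real. Qed.

Lemma form_real_expand (t : R) u v :
  re (B (u + t%:C *: v) (u + t%:C *: v)) =
  re (B u u) + 2 * t * re (B u v) + t ^+ 2 * re (B v v).
Proof.
rewrite form_expand conjc_real; case: (B u u) (B u v) (B v v) => [? ?] [? ?] [? ?].
by rewrite /=; ring.
Qed.

(** With opposite signs, t -> B(u + t v, u + t v) would have a real root. The vector there has norm
    0, so u = - t v and the signs agree after all. *)
Lemma form_definite u v : 0 <= re (B u u) * re (B v v).
Proof.
rewrite leNgt; apply/negP => lt0.
set a := re (B u u) in lt0; set d := re (B v v) in lt0; set b := re (B u v).
pose t := (Num.sqrt (b ^+ 2 - a * d) - b) / d.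
have d0 : d != 0 by apply: contraTneq lt0 => ->; rewrite mulr0 ltxx.
have D0 : 0 <= b ^+ 2 - a * d by have := sqr_ge0 b; lra.
have root : a + 2 * t * b + t ^+ 2 * d = 0.
  have sD := sqr_sqrtr D0; rewrite /t; move: (Num.sqrt _) sD => q sD.
  by apply: (mulIf d0); rewrite mul0r; field: sD.
have uv : u + t%:C *: v = 0.
  apply: nX_eq0; apply/eqP; rewrite -(@sqrf_eq0 R) -form_norm form_real_expand.
  by rewrite root normr0.
have uE : u = 0 + (- t)%:C *: v.
  by rewrite add0r rmorphN scaleNr; apply/eqP; rewrite -addr_eq0 uv.
have := form_real_expand (- t) 0 v; rewrite -uE -/a -/d.
rewrite !form0 (B_herm v 0) form0 /= => aE.
by have := sqr_ge0 (t * d); nra.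
Qed.

(** At the critical point t = - b / d the form drops from u to u - b^2 / d; both values have the
    sign of d, so orthogonality forces b = 0. *)
Lemma form_orth_re x y : bj_orth nA ip x y -> re (B x y) = 0.
Proof.
move=> xy; have [y0|y0] := eqVneq (re (B y y)) 0.
  have -> : y = 0; last by rewrite form0.
  by apply: nX_eq0; apply/eqP; rewrite -(@sqrf_eq0 R) -form_norm y0 normr0.
pose t := - (re (B x y) / re (B y y)).
have := xy t%:C; rewrite -(@ler_pXn2r _ 2) ?nnegrE ?sqrtr_ge0 // -!form_norm.
have := form_definite (x + t%:C *: y) y; have := form_definite x y.
rewrite form_real_expand /t.
move: (re (B x x)) (re (B x y)) (re (B y y)) y0 => u b d d0 ud.
have -> : u + 2 * - (b / d) * b + (- (b / d)) ^+ 2 * d = u - b ^+ 2 / d.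
  by field; exact: d0.
move: (b / d) (divfK d0 b) => q qb; rewrite -qb.
rewrite (_ : (q * d) ^+ 2 / d = q ^+ 2 * d); last by field; exact: d0.
move=> wd; rewrite -ler_sqr ?nnegrE // !real_normK ?num_real // => le.
(* Multiplying by d makes both sides nonnegative whatever the sign of d. *)
have le2 : (u * d) ^+ 2 <= ((u - q ^+ 2 * d) * d) ^+ 2.
  by rewrite !exprMn ler_wpM2r ?sqr_ge0.
rewrite ler_sqr ?nnegrE // in le2; apply/eqP; rewrite -sqrf_eq0 eq_le sqr_ge0.
by rewrite andbT; nra.
Qed.

(** The cross term vanishes and the two values share a sign, so |x + y|^2 = |x|^2 + |y|^2. *)
Lemma form_symm x y : bj_orth nA ip x y -> nX y <= nX (x + y).
Proof.
move=> xy; rewrite -(@ler_pXn2r _ 2) ?nnegrE ?sqrtr_ge0 // -!form_norm.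
have := form_real_expand 1 x y; rewrite scale1r (form_orth_re xy) => ->.
rewrite mulr0 addr0 expr1n mul1r; have := form_definite x y.
move: (re _) (re _) => a d ad; rewrite -ler_sqr ?nnegrE //.
by rewrite !real_normK ?num_real //; nra.
Qed.

End ScalarForm.

(** * Either isomorphism yields a scalar form *)

(** The preimage of 1 has norm 1 by the C*-identity, so phi is isometric and phi <u, v> is the
    form. *)
Lemma cstar_iso_symm : cstar_iso_C mul star ->
  forall x y, bj_orth nA ip x y -> nX y <= nX (x + y).
Proof.
move=> [phi [phi_inj phi_surj phi_lin phiM phi_star]] x y.
have phiZ : forall c b, phi (c *: b) = c * phi b.
  by move=> c b; exact: (@linZ _ _ C^o phi phi_lin).
have [e phie] := phi_surj 1.
have nAe : nA e = 1.
  have e0 : nA e != 0.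
    rewrite gt_eqF //; apply: nA_gt0 => e0; have := phiZ 0 e.
    rewrite scale0r -e0 phie mul0r => /eqP; by rewrite oner_eq0.
  apply: (mulIf e0); rewrite mul1r -expr2 -nA_cstar; congr nA.
  by apply: phi_inj; rewrite phiM phi_star phie rmorph1 mulr1.
have nAphi b : nA b = cabs (phi b).
  rewrite [in LHS](_ : b = phi b *: e) ?nAZ ?nAe ?mulr1 //.
  by apply: phi_inj; rewrite phiZ phie mulr1.
apply: (@form_symm (fun u v => phi (ip u v))).
- by move=> u k v w; rewrite (ip_linr u) phi_lin.
- by move=> u v; rewrite -ip_star phi_star.
- by move=> u; rewrite nX_sqr nAphi.
Qed.

(** Every [theta] is a multiple of one of them, which turns out to be a nonzero scalar operator; the
    form is defined by v <u, z> = B(u, v) z. *)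
Lemma compact_iso_symm : (exists x : X, x <> 0) -> compact_iso_C nA act ip ->
  forall x y, bj_orth nA ip x y -> nX y <= nX (x + y).
Proof.
move=> [x0 x0n] [phi [phi_inj _ phi_lin phiM _]] x y.
pose K := compact_ops nA act ip; pose th := theta act ip.
have diff0 e (z : X) : 0 < e -> nX (z - z) <= e * nX z.
  move=> e0; rewrite subrr /hm_norm (lin0 (ip_linr 0)) nA0 sqrtr0.
  by rewrite mulr_ge0 ?sqrtr_ge0 // ltW.
(* The trailing [+ 0] matches the shape k S + T in [phi_lin]. *)
have Kth c u v : K (fun z => c *: th u v z + 0).
  move=> e e0; exists [:: (c, u, v)] => z.
  by rewrite /theta_comb big_cons big_nil subrr -(subrr z) diff0.
have ext (S T : X -> X) : (forall z, S z = T z) -> S = T.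
  exact: functional_extensionality_dep.
have Kth1 u v : K (th u v).
  rewrite (_ : th u v = fun z => 1 *: th u v z + 0); first exact: Kth.
  by apply: ext => z; rewrite scale1r addr0.
have K0 : K (fun=> 0).
  rewrite (_ : (fun=> 0) = fun z => 0 *: th x0 x0 z + 0); first exact: Kth.
  by apply: ext => z; rewrite scale0r addr0.
have phi0 : phi (fun=> 0) = 0.
  have := phi_lin (-1) _ _ K0 K0.
  have -> : (fun z : X => -1 *: (0 : X) + 0) = (fun z : X => 0).
    by apply: ext => z; rewrite scaler0 addr0.
  by rewrite mulN1r addNr.
have sq_neq0 u : act u (ip u u) = 0 -> u = 0.
  move=> u0; apply: ip_eq0; apply: star_mul_eq0.
  by rewrite ip_sa -ip_act u0 (lin0 (ip_linr u)).
set t0 := th x0 x0; set k := phi t0.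
have k0 : k != 0.
  apply/eqP => k0; apply: x0n; apply: sq_neq0.
  change (t0 x0 = 0).
  have -> : t0 = fun=> 0 by apply: phi_inj; rewrite ?phi0 //; exact: Kth1.
  by [].
have thE u v : th u v = fun z => (phi (th u v) / k) *: t0 z.
  transitivity (fun z => (phi (th u v) / k) *: t0 z + 0); last first.
    by apply: ext => z; rewrite addr0.
  apply: phi_inj; [exact: Kth1|exact: Kth|].
  by rewrite (phi_lin _ _ _ (Kth1 _ _) K0) phi0 addr0 divfK.
have t0lin : linear t0.
  by move=> c u v; rewrite /t0 /th /theta (ip_linr x0) (act_linr x0).
have t0t0 z : t0 (t0 z) = k *: t0 z.
  have comp : (fun z => t0 (t0 z)) = th (act x0 (ip x0 x0)) x0.
    by apply: ext => w; rewrite /t0 /th /theta ip_act act_mul.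
  rewrite -[LHS]/((fun z => t0 (t0 z)) z) comp thE -comp phiM ?mulfK //;
    exact: (Kth1 x0 x0).
(* w = t0 z - k z is killed by t0, hence by theta_{w,w}, so w <w, w> = 0. *)
have t0k z : t0 z = k *: z.
  apply: subr0_eq; apply: sq_neq0.
  set w := _ - _; change (th w w w = 0); rewrite thE /w.
  by rewrite (linB t0lin) t0t0 (linZ t0lin) subrr scaler0.
pose B u v := phi (th v u).
have BE u v z : act v (ip u z) = B u v *: z.
  by change (act v (ip u z)) with (th v u z); rewrite thE t0k scalerA divfK.
have inj0 (c d : C) : c *: x0 = d *: x0 -> c = d.
  move=> /eqP; rewrite -subr_eq0 -scalerBl scaler_eq0 => /orP[|/eqP/x0n //].
  by rewrite subr_eq0 => /eqP.
apply: (@form_symm B).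
- move=> u c v w; apply: inj0; rewrite -BE (act_linl _) !BE scalerDl scalerA //.
- move=> u v.
  have h : ip x0 (act v (ip u x0)) = B u v *: ip x0 x0.
    by rewrite BE (linZ (ip_linr x0)).
  have h' : ip x0 (act u (ip v x0)) = B v u *: ip x0 x0.
    by rewrite BE (linZ (ip_linr x0)).
  have := congr1 star h; rewrite starZ ip_sa ip_act (cs_starM HA) !ip_star.
  rewrite -ip_act h' => /eqP; rewrite -subr_eq0 -scalerBl scaler_eq0.
  by move=> /orP[|/eqP/ip_eq0/x0n //]; rewrite subr_eq0 => /eqP.
- move=> u; have [->|/eqP u0] := eqVneq u 0.
    have := BE 0 0 x0; rewrite (lin0 (act_linl _)) => /esym/eqP.
    rewrite scaler_eq0 => /orP[/eqP ->|/eqP/x0n //].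
    by rewrite nX_sqr (lin0 (ip_linr 0)) nA0 Normc.normc0.
  have n0 : nA (ip u u) != 0 by rewrite gt_eqF //; apply: nA_gt0 => /ip_eq0.
  apply: (mulIf n0); rewrite nX_sqr -expr2 -nA_cstar ip_sa -ip_act BE.
  by rewrite (linZ (ip_linr u)) nAZ.
Qed.

(** * The equivalence, starting from a normalized vector *)

Lemma symm_iso : full_module mul nA ip -> (exists x : X, x <> 0) ->
  (forall x y, bj_orth nA ip x y -> nX y <= nX (x + y)) ->
  cstar_iso_C mul star \/ compact_iso_C nA act ip.
Proof.
move=> full [x0 x0n] symm; have [_ x1 _] := unit_scale x0n.
exact: (rank_one_iso (ip_cube symm) x1 (ip_cube_unit symm x1).2 full).
Qed.

End HilbertModule.
End CstarAlgebra.

Theorem theorem4p2 (R : realType)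
    (A : lmodType R[i]) (mul : A -> A -> A) (star : A -> A) (nA : A -> R)
    (X : lmodType R[i]) (act : X -> A -> X) (ip : X -> X -> A)
    (HA : is_cstar_algebra mul star nA)
    (HX : is_hilbert_module mul star nA act ip)
    (Hfull : full_module mul nA ip)
    (Hnontriv : exists x : X, x <> 0) :
  (forall x y : X, bj_orth nA ip x y ->
      hm_norm nA ip y <= hm_norm nA ip (x + y))
  <-> (cstar_iso_C mul star \/ compact_iso_C nA act ip).
Proof.
split; first exact: symm_iso.
by case; [exact: (cstar_iso_symm HA HX) | exact: (compact_iso_symm HA HX)].
Qed.
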